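(* Let $V$ be a vector space over a field $k$ and let $\varphi\in\mathrm{End}_k(V)$ be a finite potent endomorphism with AST decomposition $V=W_\varphi\oplus U_\varphi$. Then an endomorphism $\psi\in\mathrm{End}_k(V)$ is a GD1 inverse of $\varphi$ if and only if $\psi\in X_\varphi(1,2)$ and $\psi(W_\varphi)\subseteq W_\varphi$.
   Context: $k$ is an arbitrary field, $V$ an arbitrary (possibly infinite-dimensional) $k$-vector space. An endomorphism $\varphi\in\mathrm{End}_k(V)$ is finite potent if $\varphi^n(V)$ is finite dimensional for some $n\ge 1$. For such $\varphi$ there is a unique $\varphi$-invariant decomposition $V=W_\varphi\oplus U_\varphi$ (the AST decomposition) with $W_\varphi$ finite dimensional, $\varphi|_{W_\varphi}$ an automorphism of $W_\varphi$, and $\varphi|_{U_\varphi}$ nilpotent; the index $i(\varphi)$ is the nilpotency order of $\varphi|_{U_\varphi}$ ($i(\varphi)=0$ iff $V$ is finite dimensional and $\varphi$ is an automorphism). Put $m=i(\varphi)$. A $\{1\}$-inverse of $\varphi$ is $\varphi^-\in\mathrm{End}_k(V)$ with $\varphi\varphi^-\varphi=\varphi$; the set of them is $X_\varphi(1)$. $X_\varphi(1,2)$ is the set of reflexive generalized inverses, i.e. $\psi\in\mathrm{End}_k(V)$ with $\varphi\psi\varphi=\varphi$ and $\psi\varphi\psi=\psi$. A G-Drazin inverse of $\varphi$ is $\varphi^{GD}\in\mathrm{End}_k(V)$ with $\varphi\varphi^{GD}\varphi=\varphi$ and $\varphi^{GD}\varphi^m=\varphi^m\varphi^{GD}$; the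 set of them is $X_\varphi(GD)$. A GD1 inverse of $\varphi$ is $\psi\in\mathrm{End}_k(V)$ such that $\psi\varphi\psi=\psi$, $\psi\varphi=\varphi^{GD}\varphi$ and $\varphi\psi=\varphi\varphi^-$ for some $\varphi^-\in X_\varphi(1)$ and $\varphi^{GD}\in X_\varphi(GD)$. *)

(* Defs.v *)
From mathcomp Require Import all_boot all_order all_algebra.
From mathcomp Require Import boolp classical_sets functions.

Set Implicit Arguments.
Unset Strict Implicit.
Unset Printing Implicit Defensive.

Import GRing.Theory.

Local Open Scope classical_set_scope.
Local Open Scope ring_scope.

(* V is an arbitrary k-vector space, so subspaces are sets closed under linear
   combinations (vector.v's {vspace _} only covers finite dimension).
   Powers of an endomorphism are iterates: iter n phi. *)

Definition lin_span (k : fieldType) (V : lmodType k) (s : seq V) : set V :=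
  [set v | exists c : 'I_(size s) -> k, v = \sum_(i < size s) c i *: s`_i].

Definition fin_dim (k : fieldType) (V : lmodType k) (A : set V) : Prop :=
  exists s : seq V, A = lin_span s.

Definition finite_potent (k : fieldType) (V : lmodType k)
    (phi : {linear V -> V}) : Prop :=
  exists2 n : nat, (1 <= n)%N & fin_dim (range (iter n phi)).

Definition direct_sum (k : fieldType) (V : lmodType k) (W U : set V) : Prop :=
  [/\ submod_closed (mem W), submod_closed (mem U), W `&` U = [set 0]
    & forall v : V, exists w u : V, [/\ W w, U u & v = w + u]].

Definition vanishes_on (k : fieldType) (V : lmodType k) (f : V -> V)
    (U : set V) : Prop :=
  forall u : V, U u -> f u = 0.

Definition nilpotent_on (k : fieldType) (V : lmodType k) (f : V -> V)
    (U : set V) : Prop :=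
  exists n : nat, vanishes_on (iter n f) U.

Record AST_decomposition (k : fieldType) (V : lmodType k)
    (phi : {linear V -> V}) (W U : set V) : Prop := {
  AST_direct_sum : direct_sum W U;
  AST_invariantW : phi @` W `<=` W;
  AST_invariantU : phi @` U `<=` U;
  AST_fin_dim : fin_dim W;
  AST_automorphism : set_bij W W phi;
  AST_nilpotent : nilpotent_on phi U }.

(* The order may be 0, which happens exactly when U = 0. *)
Definition nilpotency_order (k : fieldType) (V : lmodType k) (f : V -> V)
    (U : set V) (m : nat) : Prop :=
  vanishes_on (iter m f) U /\
  forall n : nat, vanishes_on (iter n f) U -> (m <= n)%N.

(* i(phi) = m, as a relation; by uniqueness of the AST decomposition at most
   one m satisfies it. *)
Definition fp_index (k : fieldType) (V : lmodType k) (phi : {linear V -> V})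
    (m : nat) : Prop :=
  exists W U : set V, AST_decomposition phi W U /\ nilpotency_order phi U m.

Definition inverse1 (k : fieldType) (V : lmodType k)
    (phi psi : {linear V -> V}) : Prop :=
  phi \o psi \o phi =1 phi.

Definition inverse12 (k : fieldType) (V : lmodType k)
    (phi psi : {linear V -> V}) : Prop :=
  phi \o psi \o phi =1 phi /\ psi \o phi \o psi =1 psi.

Definition GDrazin_inverse (k : fieldType) (V : lmodType k)
    (phi chi : {linear V -> V}) : Prop :=
  phi \o chi \o phi =1 phi /\
  exists2 m : nat, fp_index phi m & chi \o iter m phi =1 iter m phi \o chi.

Definition GD1_inverse (k : fieldType) (V : lmodType k)
    (phi psi : {linear V -> V}) : Prop :=
  exists phi1 phiGD : {linear V -> V},
    [/\ inverse1 phi phi1, GDrazin_inverse phi phiGD,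
        psi \o phi \o psi =1 psi,
        psi \o phi =1 phiGD \o phi
      & phi \o psi =1 phi \o phi1].

(* Main.v *)
(** A reflexive inverse [psi] with [psi W] in [W] is the inverse of [phi] on
    [W].  As the kernel of [phi] lies in [U], the projections [p] onto [W] and
    [q] onto [U] turn [psi] into the G-Drazin inverse [psi p + q psi q], which
    agrees with [psi] on the image of [phi].  Conversely, the image of
    [phi ^ m] is [W] for [m] the index, so an endomorphism commuting with
    [phi ^ m] preserves [W]. *)

Require Import Defs.
From HB Require Import structures.
From mathcomp Require Import all_boot all_order all_algebra.
From mathcomp Require Import boolp classical_sets functions.

Set Implicit Arguments.
Unset Strict Implicit.
Unset Printing Implicit Defensive.

Local Open Scope classical_set_scope.
Local Open Scope ring_scope.

Import GRing.Theory.

Section LinearMaps.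
Variables (k : fieldType) (V : lmodType k).

(** A bare iterate carries no linear structure; replacing it by [g] makes the rules for linear maps
    applicable to it. *)
Lemma iter_linearE (f : {linear V -> V}) n :
  exists g : {linear V -> V}, g =1 iter n f.
Proof.
have lin_iter : linear (iter n f).
  by move=> a u v; elim: n => //= n ->; rewrite linearP.
pose mix := GRing.isLinear.Build k V V *:%R (iter n f) lin_iter.
pose g : {linear V -> V} := HB.pack (iter n f) mix.
by exists g.
Qed.

Lemma submod_closedP (S : set V) : submod_closed (mem S) ->
  S 0 /\ forall a u v, S u -> S v -> S (a *: u + v).
Proof.
case=> /set_mem S0 Sl; split=> // a u v Su Sv.
by apply/set_mem/Sl; apply/mem_set.
Qed.

Lemma submodD (S : set V) u v : submod_closed (mem S) -> S u -> S v -> S (u + v).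
Proof. by move=> /submod_closedP[_ Sl] Su Sv; rewrite -[u]scale1r; exact: Sl. Qed.

Lemma submodB (S : set V) u v : submod_closed (mem S) -> S u -> S v -> S (u - v).
Proof.
by move=> /submod_closedP[_ Sl] Su Sv; rewrite addrC -scaleN1r; exact: Sl.
Qed.

Lemma direct_sum_uniq (W U : set V) w u w' u' : direct_sum W U ->
  W w -> U u -> W w' -> U u' -> w + u = w' + u' -> w = w' /\ u = u'.
Proof.
case=> subW subU WU0 _ Ww Uu Ww' Uu' e.
have e' : w - w' = u' - u.
  by apply/eqP; rewrite subr_eq addrAC [u' + _]addrC -e addrK.
have : (W `&` U) (w - w').
  by split; [exact: submodB | rewrite e'; exact: submodB].
rewrite WU0 /= => d0; split; first by apply/eqP; rewrite -subr_eq0 d0.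
by apply/esym/eqP; rewrite -subr_eq0 -e' d0.
Qed.

(** The components are chosen pointwise, and uniqueness of the decomposition forces the chosen
    functions to be linear. *)
Lemma direct_sum_projections (W U : set V) : direct_sum W U ->
  exists p q : {linear V -> V},
    forall v, [/\ W (p v), U (q v) & v = p v + q v].
Proof.
move=> WU; have [subW subU _ dec] := WU.
have [pq pqP] : {pq : V -> V * V &
    forall v, [/\ W (pq v).1, U (pq v).2 & v = (pq v).1 + (pq v).2]}.
  apply: (@choice _ _ (fun v x => [/\ W x.1, U x.2 & v = x.1 + x.2])) => v.
  by have [w [u wu]] := dec v; exists (w, u).
have lin_pq a u v : (pq (a *: u + v)).1 = a *: (pq u).1 + (pq v).1 /\
    (pq (a *: u + v)).2 = a *: (pq u).2 + (pq v).2.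
  have [Wu Uu eu] := pqP u; have [Wv Uv ev] := pqP v.
  have [Ws Us es] := pqP (a *: u + v).
  have [_ lW] := submod_closedP subW; have [_ lU] := submod_closedP subU.
  apply: (direct_sum_uniq WU) => //; [exact: lW | exact: lU | rewrite -es].
  by rewrite {1}eu {1}ev scalerDr addrACA.
have lin_p : linear (fun v => (pq v).1) by move=> a u v; case: (lin_pq a u v).
have lin_q : linear (fun v => (pq v).2) by move=> a u v; case: (lin_pq a u v).
pose mixp := GRing.isLinear.Build k V V *:%R _ lin_p.
pose mixq := GRing.isLinear.Build k V V *:%R _ lin_q.
pose p : {linear V -> V} := HB.pack (fun v => (pq v).1) mixp.
pose q : {linear V -> V} := HB.pack (fun v => (pq v).2) mixq.
by exists p, q.
Qed.

End LinearMaps.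

Section AST.
Variables (k : fieldType) (V : lmodType k) (phi : {linear V -> V}).

Lemma AST_iterW (W U : set V) n w : AST_decomposition phi W U ->
  W w -> W (iter n phi w).
Proof.
by case=> _ invW _ _ _ _ Ww; elim: n => //= n IH; apply: invW; exists (iter n phi w).
Qed.

Lemma AST_iter_surjW (W U : set V) n w : AST_decomposition phi W U ->
  W w -> exists2 w', W w' & w = iter n phi w'.
Proof.
case=> _ _ _ _ [_ _ surjW] _; elim: n w => [|n IH] w Ww; first by exists w.
have [w1 Ww1 <-] := surjW w Ww; have [w2 Ww2 ->] := IH _ Ww1.
by exists w2.
Qed.

Lemma AST_iter_range (W U : set V) n v : AST_decomposition phi W U ->
  vanishes_on (iter n phi) U -> W (iter n phi v).
Proof.
move=> hAST nilU; have [_ _ _ dec] := AST_direct_sum hAST.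
have [w [u [Ww Uu ->]]] := dec v; have [g gE] := iter_linearE phi n.
by rewrite -gE linearD !gE (nilU u) // addr0; exact: AST_iterW hAST Ww.
Qed.

(** The index in [GDrazin_inverse] comes with a decomposition of its own, whose first summand must
    be compared with the given one. A power of [phi] that kills [U'] sends everything into [W'],
    while [W] lies in the image of every power. *)
Lemma AST_W_sub (W U W' U' : set V) : AST_decomposition phi W U ->
  AST_decomposition phi W' U' -> W `<=` W'.
Proof.
move=> hAST hAST' w Ww; have [n nilU'] := AST_nilpotent hAST'.
by have [w' _ ->] := AST_iter_surjW n hAST Ww; exact: AST_iter_range hAST' nilU'.
Qed.

Lemma AST_kerU (W U : set V) v : AST_decomposition phi W U ->
  phi v = 0 -> U v.
Proof.
case=> WU invW invU _ [_ injW _] _.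
have [subW subU _ dec] := WU; have [w [u [Ww Uu ->]]] := dec v.
have W0 := (submod_closedP subW).1; have U0 := (submod_closedP subU).1.
rewrite linearD -[RHS]addr0 => e.
have [phiw0 _] : phi w = 0 /\ phi u = 0.
  apply: (direct_sum_uniq WU) => //; first by apply: invW; exists w.
  by apply: invU; exists u.
suff -> : w = 0 by rewrite add0r.
by apply: injW; rewrite ?inE // phiw0 linear0.
Qed.

Lemma nilpotency_order_exists (f : V -> V) (U : set V) : nilpotent_on f U ->
  exists m, nilpotency_order f U m.
Proof.
move=> [n nilU].
have ex : exists n, `[< vanishes_on (iter n f) U >] by exists n; apply/asboolP.
case: (ex_minnP ex) => m /asboolP nilm minm; exists m; split=> // j nilj.
by apply/minm/asboolP.
Qed.

Lemma GDrazin_inverse_W (W U : set V) (chi : {linear V -> V}) w :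
  AST_decomposition phi W U -> GDrazin_inverse phi chi -> W w -> W (chi w).
Proof.
move=> hAST [_ [m [W' [U' [hAST' [nilU' _]]]] comm]] Ww.
have [w' _ ->] := AST_iter_surjW m hAST Ww.
apply: (AST_W_sub hAST' hAST); have /= -> := comm w'.
exact: AST_iter_range hAST' nilU'.
Qed.

Lemma GDrazin_inverse_exists (W U : set V) (psi : {linear V -> V}) :
  AST_decomposition phi W U -> phi \o psi \o phi =1 phi -> psi @` W `<=` W ->
  exists2 chi, GDrazin_inverse phi chi & psi \o phi =1 chi \o phi.
Proof.
move=> hAST ppp psiW; have [WU invW invU _ [_ injW _] nilU] := hAST.
have [subW subU _ _] := WU.
have [p [q pqP]] := direct_sum_projections WU.
have U0 := (submod_closedP subU).1; have W0 := (submod_closedP subW).1.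
have pqW w : W w -> p w = w /\ q w = 0.
  by case: (pqP w) => Wp Uq /esym e Ww; apply: (direct_sum_uniq WU); rewrite ?addr0.
have pqU u : U u -> p u = 0 /\ q u = u.
  by case: (pqP u) => Wp Uq /esym e Uu; apply: (direct_sum_uniq WU); rewrite ?add0r.
have psi_phiW w : W w -> psi (phi w) = w.
  (* Both sides lie in [W] and have the same image under [phi], which is injective there. *)
  move=> Ww; apply: injW; rewrite ?inE //; last exact: ppp.
  by apply: psiW; exists (phi w) => //; apply: invW; exists w.
have psi_phiU u : U u -> U (psi (phi u)).
  (* The difference [psi (phi u) - u] is in the kernel of [phi], hence in [U]. *)
  move=> Uu; rewrite -[psi _](subrK u); apply: submodD => //.
  by apply: (AST_kerU hAST); rewrite linearB; apply/eqP; rewrite subr_eq0; apply/eqP/ppp.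
pose chi : {linear V -> V} := (psi \o p) \+ (q \o psi \o q).
have chiW w : W w -> chi w = psi w.
  by move=> Ww; rewrite /chi /=; have [-> ->] := pqW w Ww; rewrite !linear0 addr0.
have chiU u : U u -> chi u = q (psi u).
  by move=> Uu; rewrite /chi /=; have [-> ->] := pqU u Uu; rewrite linear0 add0r.
have chi_phi v : chi (phi v) = psi (phi v).
  case: (pqP v) => Wp Uq ->; rewrite !linearD chiW ?chiU.
  - by congr (_ + _); case: (pqU _ (psi_phiU _ Uq)).
  - by apply: invU; exists (q v).
  - by apply: invW; exists (p v).
clearbody chi.
have [m ordm] := nilpotency_order_exists nilU.
exists chi; last by move=> v /=; rewrite chi_phi.
split; first by move=> v /=; rewrite chi_phi; exact: ppp.
exists m; first by exists W, U.
have [g gE] := iter_linearE phi m.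
move=> v /=; rewrite -!gE; case: (pqP v) => Wp Uq ->; rewrite !linearD.
congr (_ + _); rewrite !gE.
  (* On [W], writing [p v] as [phi w] and cancelling one [phi] with [chi] reduces both sides to
     [iter m phi w]. *)
  have [w Ww ->] := AST_iter_surjW 1 hAST Wp.
  by rewrite /= -iterSr iterS !chi_phi !psi_phiW //; exact: AST_iterW hAST Ww.
(* On [U] both sides vanish, as [q v] and its image under [chi] lie in [U]. *)
have [nilm _] := ordm; rewrite nilm // linear0 chiU // nilm //.
by have [] := pqP (psi (q v)).
Qed.

End AST.

Theorem theorem3p10 (k : fieldType) (V : lmodType k)
    (phi : {linear V -> V}) (hphi : finite_potent phi)
    (W U : set V) (hAST : AST_decomposition phi W U)
    (psi : {linear V -> V}) :
  GD1_inverse phi psi <-> (inverse12 phi psi /\ psi @` W `<=` W).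
Proof.
split=> [[phi1 [chi [inv1 GD psipsi psiphi phipsi]]]|[[phiphi psipsi] psiW]].
  split; first by split=> // v; have /= -> := phipsi (phi v); exact: inv1.
  (* [psi] and [chi] agree only on the image of [phi], so [w] is first written as the image of some
     [w'] in [W]. *)
  move=> _ [w Ww <-]; have [w' Ww' ->] := AST_iter_surjW 1 hAST Ww.
  have /= -> := psiphi w'; apply: (GDrazin_inverse_W hAST GD).
  exact: (AST_iterW 1 hAST).
have [chi GD psichi] := GDrazin_inverse_exists hAST phiphi psiW.
(* The reflexive inverse [psi] serves as its own {1}-inverse. *)
by exists psi, chi.
Qed.
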